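(* Let $D$ be an integral domain and let $\Theta$ be a Jaffard family of $D$. Then there is an exact sequence $$0\longrightarrow\mathrm{Pic}(D,\Theta)\longrightarrow\mathrm{Pic}(\mathrm{Int}(D))\longrightarrow\bigoplus_{T\in\Theta}\mathrm{Pic}(\mathrm{Int}(T))\longrightarrow 0,$$ where the first map is $[I]\mapsto[I\,\mathrm{Int}(D)]$ and the second is $[J]\mapsto([J\,\mathrm{Int}(T)])_{T\in\Theta}$.
   Context: $D$ is an integral domain with quotient field $K$; $\mathrm{Int}(A)=\{f\in K[X]\mid f(A)\subseteq A\}$ for an overring $A$ of $D$. For an integral domain $A$, $\mathrm{Pic}(A)$ is the group of invertible fractional ideals of $A$ modulo principal fractional ideals. An overring is a ring between $D$ and $K$; it is flat if it is flat as a $D$-module. For a family $\Theta$ of flat overrings, $\mathrm{Pic}(D,\Theta)=\{[I]\in\mathrm{Pic}(D)\mid IT \text{ is principal for all } T\in\Theta\}$. A family $\Theta$ of overrings of $D$ is a pre-Jaffard family if: either $\Theta=\{K\}$ or $K\notin\Theta$; every $T\in\Theta$ is flat over $D$; $\Theta$ is complete (every ideal $I$ of $D$ satisfies $I=\bigcap_{T\in\Theta}IT$); $\Theta$ is independent ($TT'=K$ for $T\neq T'$ in $\Theta$); and $\Theta$ is compact in the Zariski topology of the set of overrings of $D$ (the topology with subbasic open sets $\{T\mid x_1,\dots,x_n\in T\}$, $x_i\in K$). A Jaffard family is a pre-Jaffard family that is locally finite: every nonzero $x\in D$ is a nonunit in only finitely many $T\in\Theta$. *)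

(* Defs.v *)
From Stdlib Require List.
From HB Require Import structures.
From mathcomp Require Import all_boot all_order all_algebra.
Set Implicit Arguments. Unset Strict Implicit. Unset Printing Implicit Defensive.
Import GRing.Theory.
Local Open Scope ring_scope.

Section Generic.
Variable F : fieldType.

Definition subring (A : F -> Prop) : Prop :=
  [/\ A 0, A 1, (forall x y, A x -> A y -> A (x - y)) & (forall x y, A x -> A y -> A (x * y))].

Definition prodset (A B : F -> Prop) : F -> Prop :=
  fun x => exists s : seq (F * F),
    (forall p, List.In p s -> A p.1 /\ B p.2) /\ x = \sum_(p <- s) p.1 * p.2.

Definition same_set (A B : F -> Prop) : Prop := forall x, A x <-> B x.

Definition submodule (A J : F -> Prop) : Prop :=
  [/\ J 0, (forall x y, J x -> J y -> J (x + y)) & (forall a x, A a -> J x -> J (a * x))].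

Definition ideal (A J : F -> Prop) : Prop := submodule A J /\ (forall x, J x -> A x).

(* nonzero fractional ideal of A (F is the quotient field of A) *)
Definition frac_ideal (A J : F -> Prop) : Prop :=
  [/\ submodule A J, (exists x, J x /\ x != 0)
    & exists d, [/\ A d, d != 0 & forall x, J x -> A (d * x)]].

Definition invertible (A J : F -> Prop) : Prop :=
  frac_ideal A J /\ exists J', frac_ideal A J' /\ same_set (prodset J J') A.

Definition principal (A J : F -> Prop) : Prop :=
  exists x, x != 0 /\ same_set J (fun y => exists a, A a /\ y = x * a).

(* equality of classes in Pic: J1 = x J2 for some nonzero x *)
Definition same_class (J1 J2 : F -> Prop) : Prop :=
  exists x, x != 0 /\ same_set J1 (fun y => exists j, J2 j /\ y = x * j).

Definition is_unit_in (A : F -> Prop) (x : F) : Prop := exists y, A y /\ x * y = 1.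

End Generic.

Section Setting.
Variable K : fieldType.

Definition quotient_field_of (D : K -> Prop) : Prop :=
  subring D /\ forall x, exists a b, [/\ D a, D b, b != 0 & x = a / b].

Definition overring (D T : K -> Prop) : Prop :=
  subring T /\ forall x, D x -> T x.

(* flatness of T as a D-module, via the equational criterion *)
Definition flat_over (D T : K -> Prop) : Prop :=
  forall (n : nat) (a t : 'I_n -> K),
    (forall k, D (a k)) -> (forall k, T (t k)) -> \sum_k a k * t k = 0 ->
    exists (m : nat) (b : 'I_n -> 'I_m -> K) (y : 'I_m -> K),
      [/\ forall k l, D (b k l), forall l, T (y l),
          forall k, t k = \sum_l b k l * y l
        & forall l, \sum_k a k * b k l = 0].

Definition zariski_open (D : K -> Prop) (U : (K -> Prop) -> Prop) : Prop :=
  forall R, overring D R -> U R ->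
    exists xs : seq K, (forall x, List.In x xs -> R x) /\
      forall R', overring D R' -> (forall x, List.In x xs -> R' x) -> U R'.

Definition pre_jaffard (D : K -> Prop) (I : Type) (T : I -> K -> Prop) : Prop :=
      (forall i, overring D (T i)) /\
      (forall i j, i <> j -> ~ same_set (T i) (T j)) /\
      ((inhabited I /\ forall i x, T i x) \/ (forall i, exists x, ~ T i x)) /\
      (forall i, flat_over D (T i)) /\
      (forall J, ideal D J -> same_set J (fun x => forall i, prodset J (T i) x)) /\
      (forall i j, i <> j -> forall x, prodset (T i) (T j) x) /\
      (forall (Jx : Type) (U : Jx -> (K -> Prop) -> Prop),
         (forall j, zariski_open D (U j)) -> (forall i, exists j, U j (T i)) ->
         exists js : seq Jx, forall i, exists j, List.In j js /\ U j (T i)).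

Definition jaffard (D : K -> Prop) (I : Type) (T : I -> K -> Prop) : Prop :=
  pre_jaffard D T /\
  forall x, D x -> x != 0 ->
    exists s : seq I, forall i, ~ is_unit_in (T i) x -> List.In i s.

Definition Int (A : K -> Prop) : {poly K} -> Prop :=
  fun f => forall a, A a -> A f.[a].

(* Int(A) seen inside its quotient field K(X) *)
Definition KX := {fraction {poly K}}.
Definition embedP (f : {poly K}) : KX := @FracField.tofrac _ f.
Definition IntF (A : K -> Prop) : KX -> Prop :=
  fun y => exists f, Int A f /\ y = embedP f.
Definition embedK (x : K) : KX := embedP x%:P.

Definition extInt (D : K -> Prop) (J : K -> Prop) : KX -> Prop :=
  prodset (fun y => exists x, J x /\ y = embedK x) (IntF D).

Definition in_PicTheta (D : K -> Prop) (I : Type) (T : I -> K -> Prop) (J : K -> Prop) :=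
  invertible D J /\ forall i, principal (T i) (prodset J (T i)).

End Setting.

(* Main.v *)
(* Every element of K(X) can be tested locally: x lies in J T_i iff the d in D with d x in J generate the unit ideal of T_i, and completeness turns membership in all J T_i into membership in J. Since K[X] is a PID, an invertible ideal of Int(T_i) can be scaled so that it lies in K[X] and contains a nonzero constant. Independence, flatness and local finiteness then show that a family of such ideals L_i, almost all containing Int(T_i), is recovered from its intersection J by J T_i = L_i. Taking L_i = Int(T_i) gives Int(D) T_i = Int(T_i); the general case gives surjectivity. For the kernel, a scaled J with J Int(T_i) = u_i Int(T_i) has constant u_i, so J is extended from J \cap K. *)
From Stdlib Require List.
From Stdlib Require Import Classical ClassicalEpsilon.
Require Import Defs.
From HB Require Import structures.
From mathcomp Require Import all_boot all_order all_algebra.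
From mathcomp Require Import ring.
Set Implicit Arguments. Unset Strict Implicit. Unset Printing Implicit Defensive.
Import GRing.Theory.
Local Open Scope ring_scope.

(** The class of a ratio is the quotient of its own numerator by its own denominator; this needs one
    look inside the quotient construction. It supplies [emb_frac] when the abstract field below is
    specialized to [K(X)]. *)
Lemma fraction_quotient (R : idomainType) (x : {fraction R}) :
  exists a b, b != 0 /\ x = FracField.tofrac a / FracField.tofrac b.
Proof.
elim/quotW: x => r; exists \n_r, \d_r; split; first exact: denom_ratioP.
have d0 : FracField.tofrac \d_r != 0 by rewrite tofrac_eq0 denom_ratioP.
apply: (mulIf d0); rewrite divfK // -[LHS]/(FracField.mul _ _) !piE.
apply/eqmodP; rewrite /= FracField.equivfE /FracField.mulf.
by rewrite !numden_Ratio ?mulf_neq0 ?oner_eq0 ?denom_ratioP // !mulr1 mulrC.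
Qed.

(** * Products of subsets, submodules and invertible ideals in a field *)

Section Products.
Variable F : fieldType.
Implicit Types A B C J : F -> Prop.

Lemma prodset_ind A B (P : F -> Prop) :
  P 0 -> (forall x y, P x -> P y -> P (x + y)) ->
  (forall x y, A x -> B y -> P (x * y)) -> forall z, prodset A B z -> P z.
Proof.
move=> P0 PD PM z [s [sAB ->]].
elim: s sAB => [|p s IHs] sAB; first by rewrite big_nil.
rewrite big_cons; apply: PD.
  by have [] := sAB p (or_introl erefl); apply: PM.
by apply: IHs => q qs; apply: sAB; right.
Qed.

Lemma prodset_mul A B x y : A x -> B y -> prodset A B (x * y).
Proof.
move=> Ax By; exists [:: (x, y)]; split; last by rewrite big_seq1.
by move=> p [<-|[]].
Qed.

Lemma prodset0 A B : prodset A B 0.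
Proof. by exists [::]; split=> //; rewrite big_nil. Qed.

Lemma prodsetD A B x y : prodset A B x -> prodset A B y -> prodset A B (x + y).
Proof.
move=> [s [sAB ->]] [t [tAB ->]]; exists (s ++ t); split; last by rewrite big_cat.
by move=> p /List.in_app_iff[/sAB|/tAB].
Qed.

Lemma prodsetC A B x : prodset A B x -> prodset B A x.
Proof.
move: x; apply: prodset_ind; [exact: prodset0|exact: prodsetD|].
by move=> x y Ax By; rewrite mulrC; apply: prodset_mul.
Qed.

Lemma prodset_mono A B A' B' x : (forall y, A y -> A' y) -> (forall y, B y -> B' y) ->
  prodset A B x -> prodset A' B' x.
Proof. by move=> sA sB [s [sAB ->]]; exists s; split=> // p /sAB[/sA ? /sB]. Qed.

(** Regroup [(a s)(b t)] as [(a b)(s t)]. This makes extension to a larger ring multiplicative, and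
    lets denominators be multiplied. *)
Lemma prodset_mul2 A B C T x y : (forall s t, T s -> T t -> T (s * t)) ->
  (forall a b, A a -> B b -> C (a * b)) ->
  prodset A T x -> prodset B T y -> prodset C T (x * y).
Proof.
move=> TM ABC xP; apply: (prodset_ind (P := fun y => prodset C T (x * y))).
- by rewrite mulr0; apply: prodset0.
- by move=> u v; rewrite mulrDr; apply: prodsetD.
move=> b t Bb Tt; move: x xP; apply: prodset_ind.
- by rewrite mul0r; apply: prodset0.
- by move=> u v; rewrite mulrDl; apply: prodsetD.
by move=> a s Aa Ts; rewrite mulrACA; apply: prodset_mul; [apply: ABC | apply: TM].
Qed.

Lemma prodset_submodulel A J B : submodule A J -> submodule A (prodset J B).
Proof.
move=> [_ _ JM]; split; [exact: prodset0|exact: prodsetD|move=> a x Aa].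
move: x; apply: prodset_ind; first by rewrite mulr0; apply: prodset0.
  by move=> u v; rewrite mulrDr; apply: prodsetD.
by move=> u v Ju Bv; rewrite mulrA; apply: prodset_mul => //; apply: JM.
Qed.

Lemma prodset_submoduler A J B : submodule A J -> submodule A (prodset B J).
Proof.
move=> /(prodset_submodulel B)[_ _ JM]; split; [exact: prodset0|exact: prodsetD|move=> a x Aa].
by move=> /prodsetC Jx; apply/prodsetC/JM.
Qed.

Lemma prodset_le A J B M : submodule A M -> (forall x y, J x -> B y -> M (x * y)) ->
  forall x, prodset J B x -> M x.
Proof. by move=> [M0 MD _]; apply: prodset_ind. Qed.

Lemma submodule_preim A M h : submodule A M -> submodule A (fun y => M (h * y)).
Proof.
move=> [M0 MD MM]; split; first by rewrite mulr0.
  by move=> x y; rewrite mulrDr; apply: MD.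
by move=> a x; rewrite mulrCA; apply: MM.
Qed.

Lemma submodule_scale A M h :
  submodule A M -> submodule A (fun y => exists a, M a /\ y = h * a).
Proof.
move=> [M0 MD MM]; split; first by exists 0; rewrite mulr0.
  by move=> _ _ [x [Mx ->]] [y [My ->]]; exists (x + y); rewrite mulrDr; split=> //; apply: MD.
by move=> a _ Aa [x [Mx ->]]; exists (a * x); rewrite mulrCA; split=> //; apply: MM.
Qed.

Lemma prodset_same_class J1 J2 B : same_class J1 J2 -> same_class (prodset J1 B) (prodset J2 B).
Proof.
move=> [h [h0 J12]]; exists h; split=> // x.
split=> [[s [sJB ->]]|[_ [[s [sJB ->]] ->]]].
  have {}sJB p : List.In p s -> J2 (h^-1 * p.1) /\ B p.2.
    by move=> /sJB[/J12[y [J2y ->]] Bp]; rewrite mulKf.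
  exists (h^-1 * \sum_(p <- s) p.1 * p.2); rewrite mulVKf //; split=> //.
  exists [seq (h^-1 * p.1, p.2) | p <- s]; split.
    by move=> _ /List.in_map_iff[p [<- /sJB]].
  by rewrite big_map mulr_sumr; apply: eq_bigr => p _; rewrite mulrA.
exists [seq (h * p.1, p.2) | p <- s]; split.
  by move=> _ /List.in_map_iff[p [<- /sJB[Jp Bp]]]; split=> //; apply/J12; exists p.1.
by rewrite big_map mulr_sumr; apply: eq_bigr => p _; rewrite mulrA.
Qed.

Section Subring.
Variable A : F -> Prop.
Hypothesis rA : subring A.

Lemma subring0 : A 0. Proof. by case: rA. Qed.
Lemma subring1 : A 1. Proof. by case: rA. Qed.
Lemma subringB x y : A x -> A y -> A (x - y). Proof. by case: rA => _ _ + _; apply. Qed.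
Lemma subringM x y : A x -> A y -> A (x * y). Proof. by case: rA => _ _ _; apply. Qed.
Lemma subringN x : A x -> A (- x).
Proof. by move=> Ax; rewrite -[- x]add0r; apply: subringB => //; apply: subring0. Qed.
Lemma subringD x y : A x -> A y -> A (x + y).
Proof. by move=> Ax Ay; rewrite -[y]opprK; apply: subringB => //; apply: subringN. Qed.
Lemma subringX x n : A x -> A (x ^+ n).
Proof.
move=> Ax; elim: n => [|n IHn]; first by rewrite expr0; apply: subring1.
by rewrite exprS; apply: subringM.
Qed.
Lemma subring_sum n (f : 'I_n -> F) : (forall k, A (f k)) -> A (\sum_k f k).
Proof. by move=> Af; apply: (big_ind A); [apply: subring0|apply: subringD|]. Qed.
Lemma subring_submodule : submodule A A.
Proof. by split; [apply: subring0|apply: subringD|apply: subringM]. Qed.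
End Subring.

Lemma submodule_sub A B J : (forall x, A x -> B x) -> submodule B J -> submodule A J.
Proof. by move=> sAB [J0 JD JM]; split=> // a x /sAB; apply: JM. Qed.

Lemma submodule_sum A J n (f : 'I_n -> F) :
  submodule A J -> (forall k, J (f k)) -> J (\sum_k f k).
Proof. by move=> [J0 JD _] Jf; apply: (big_ind J). Qed.

(* The elements with a power in [J] form an ideal. *)
Lemma radical_proper A J B : subring A -> submodule A J ->
  (forall x, B x -> A x /\ exists n, J (x ^+ n)) -> prodset B A 1 -> J 1.
Proof.
move=> rA mJ Bn; have [J0 JD JM] := mJ => B1.
suff [_ [n]] : A 1 /\ exists n, J (1 ^+ n) by rewrite expr1n.
apply: (prodset_ind (P := fun x => A x /\ exists n, J (x ^+ n))) B1.
- by split; [apply: (subring0 rA)|exists 1%N; rewrite expr1].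
- move=> x y [Ax [m Jx]] [Ay [n Jy]]; split; first exact: (subringD rA).
  exists (m + n)%N; rewrite exprDn; apply: (submodule_sum (A := A)) => // k.
  rewrite -mulr_natr mulrC; apply: (JM).
    by elim: 'C(_, _) => [|c IHc]; rewrite ?mulr0n ?mulrS;
      [apply: (subring0 rA)|apply: (subringD rA) => //; apply: (subring1 rA)].
  have [kn|/ltnW nk] := leqP k n.
    by rewrite -addnBA // exprD -mulrA mulrC; apply: JM => //;
      apply: (subringM rA) => //; apply: (subringX rA).
  by rewrite -[X in y ^+ X](subnK nk) exprD mulrA; apply: JM => //;
    apply: (subringM rA) => //; apply: (subringX rA).
move=> x a /Bn[Ax [n Jx]] Aa; split; first exact: (subringM rA).
by exists n; rewrite exprMn mulrC; apply: JM => //; apply: (subringX rA).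
Qed.

(** The equality [J J' = A], split into an inclusion and the membership of [1]. This form passes
    easily to larger rings and can be tested locally; the conditions of [frac_ideal] are recovered
    from it afterwards. *)
Definition inverse_pair A J J' : Prop :=
  [/\ submodule A J, submodule A J', forall x y, J x -> J' y -> A (x * y)
    & prodset J J' 1].

Lemma inverse_pairC A J J' : inverse_pair A J J' -> inverse_pair A J' J.
Proof.
move=> [mJ mJ' JJ' one]; split=> //; last exact: prodsetC.
by move=> x y J'x Jy; rewrite mulrC; apply: JJ'.
Qed.

Lemma inverse_pair_ext A B J J' : subring B -> (forall x, A x -> B x) ->
  inverse_pair A J J' -> inverse_pair B (prodset J B) (prodset J' B).
Proof.
move=> rB sAB [mJ mJ' JJ' one]; have mB := subring_submodule rB.
split; [exact: prodset_submoduler|exact: prodset_submoduler| |].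
- move=> x y xP yP; have : prodset B B (x * y).
    apply: prodset_mul2 xP yP; first exact: (subringM rB).
    by move=> u v Ju J'v; apply: sAB; apply: JJ'.
  by apply: (prodset_le mB); apply: (subringM rB).
move: one; apply: prodset_mono => y Jy; rewrite -[y]mulr1; apply: prodset_mul => //.
  exact: (subring1 rB).
exact: (subring1 rB).
Qed.

Lemma invertible_inverse_pair A J : subring A -> invertible A J ->
  exists J', inverse_pair A J J'.
Proof.
move=> rA [[mJ _ _] [J' [[mJ' _ _] JJ']]]; exists J'; split=> //.
  by move=> x y Jx J'y; apply/JJ'; apply: prodset_mul.
by apply/JJ'; apply: (subring1 rA).
Qed.

Lemma prodset_neq0 A B : prodset A B 1 -> exists2 x, A x & x != 0.
Proof.
move=> AB1; apply: NNPP => noA; case/eqP: (oner_neq0 F).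
move: AB1; apply: (prodset_ind (P := fun x => x = 0)) => //.
  by move=> x y -> ->; rewrite addr0.
move=> x y Ax _; have [->|x0] := eqVneq x 0; first by rewrite mul0r.
by case: noA; exists x.
Qed.

(** A common denominator of [J] is the numerator [a] of any nonzero [y = a / b] in [J'], because
    [a x = b (x y)] with [x y] in [A]. *)
Lemma inverse_pair_invertible A J J' : subring A ->
  (forall x, exists a b, [/\ A a, A b, b != 0 & x = a / b]) ->
  inverse_pair A J J' -> invertible A J.
Proof.
move=> rA qA; have frac M M' : inverse_pair A M M' -> frac_ideal A M.
  move=> pM; have [mM _ MM' one] := pM; split=> //.
    by have [x Mx x0] := prodset_neq0 one; exists x.
  have [_ _ _ one'] := inverse_pairC pM; have [y M'y y0] := prodset_neq0 one'.
  have [a [b [Aa Ab b0 def_y]]] := qA y; exists a; split=> //.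
    by apply: contra_neq y0 => a0; rewrite def_y a0 mul0r.
  move=> x Mx; have -> : a * x = b * (x * y) by rewrite def_y; field.
  by apply: (subringM rA) => //; apply: MM'.
move=> pJ; split; first exact: frac pJ.
have [mJ mJ' JJ' one] := pJ; exists J'; split; first exact: frac (inverse_pairC pJ).
move=> x; split; first exact: prodset_le (subring_submodule rA) JJ' x.
move=> Ax; rewrite -[x]mulr1; have [_ _ +] := prodset_submodulel J' mJ.
by apply.
Qed.

End Products.

(** * Integer-valued polynomials inside the field of rational functions *)

Section Polynomials.
(* [F] stands for [K(X)]; an abstract field keeps the conversion test from unfolding the quotient construction of [{fraction {poly K}}]. *)
Variables (K F : fieldType) (emb : {rmorphism {poly K} -> F}).
Hypothesis emb_inj : injective emb.
Hypothesis emb_frac : forall x, exists f g : {poly K}, g != 0 /\ x = emb f / emb g.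
Implicit Types (A D : K -> Prop) (f g : {poly K}) (x y : F).

Definition embC (a : K) : F := emb a%:P.

Definition IntE A : F -> Prop := fun y => exists f, Int A f /\ y = emb f.

Lemma emb_eq0 f : (emb f == 0) = (f == 0).
Proof. by rewrite -(rmorph0 emb) (inj_eq emb_inj). Qed.

Lemma embC0 : embC 0 = 0. Proof. by rewrite /embC rmorph0. Qed.
Lemma embC1 : embC 1 = 1. Proof. by rewrite /embC rmorph1. Qed.
Lemma embCD (a b : K) : embC (a + b) = embC a + embC b.
Proof. by rewrite /embC polyCD rmorphD. Qed.
Lemma embCM (a b : K) : embC (a * b) = embC a * embC b.
Proof. by rewrite /embC polyCM rmorphM. Qed.
Lemma embC_eq0 (a : K) : (embC a == 0) = (a == 0).
Proof. by rewrite emb_eq0 polyC_eq0. Qed.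
Lemma embCZ (a : K) f : embC a * emb f = emb (a *: f).
Proof. by rewrite -rmorphM mul_polyC. Qed.
Lemma embCV (a : K) : embC a^-1 = (embC a)^-1.
Proof.
have [->|a0] := eqVneq a 0; first by rewrite invr0 embC0 invr0.
have a0' : embC a != 0 by rewrite embC_eq0.
by apply: (mulfI a0'); rewrite -embCM !divff // embC1.
Qed.

Lemma subring_IntE A : subring A -> subring (IntE A).
Proof.
move=> rA; split.
- by exists 0; rewrite rmorph0; split=> // a _; rewrite horner0; apply: (subring0 rA).
- by exists 1; rewrite rmorph1; split=> // a _; rewrite hornerC; apply: (subring1 rA).
- move=> _ _ [f [Af ->]] [g [Ag ->]]; exists (f - g); rewrite rmorphB; split=> // a Aa.
  by rewrite hornerD hornerN; apply: (subringB rA); [apply: Af|apply: Ag].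
move=> _ _ [f [Af ->]] [g [Ag ->]]; exists (f * g); rewrite rmorphM; split=> // a Aa.
by rewrite hornerM; apply: (subringM rA); [apply: Af|apply: Ag].
Qed.

Lemma IntE_emb A f : IntE A (emb f) -> Int A f.
Proof. by move=> [g [Ag /emb_inj->]]. Qed.

Lemma IntE_embC A (a : K) : A 0 -> IntE A (embC a) <-> A a.
Proof.
move=> A0; split=> [/IntE_emb/(_ 0 A0)|Aa]; first by rewrite hornerC.
by exists a%:P; split=> // b _; rewrite hornerC.
Qed.

Lemma Int_coef A f : subring A -> (forall k, A f`_k) -> Int A f.
Proof.
move=> rA Af a Aa; rewrite horner_coef; apply: (subring_sum rA) => k.
by apply: (subringM rA) => //; apply: (subringX rA).
Qed.

Lemma In_mem (S : eqType) (s : seq S) z : z \in s -> List.In z s.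
Proof. by elim: s => //= w s IHs; rewrite inE => /predU1P[->|/IHs]; [left|right]. Qed.

(** * Clearing denominators and normalizing invertible ideals *)

Section QuotientField.
Variable D : K -> Prop.
Hypothesis qD : quotient_field_of D.
Let rD : subring D. Proof. by case: qD. Qed.

Lemma common_denominator (s : seq K) :
  exists d, [/\ D d, d != 0 & forall a, a \in s -> D (d * a)].
Proof.
elim: s => [|a s [d [Dd d0 sD]]]; first by exists 1; split=> //; [apply: (subring1 rD)|apply: oner_neq0].
have [b [c [Db Dc c0 def_a]]] := qD.2 a.
exists (d * c); split; [exact: (subringM rD)|exact: mulf_neq0|move=> e].
rewrite inE => /predU1P[->|/sD De].
  by rewrite def_a -mulrA [c * _]mulrC divfK //; apply: (subringM rD).
by rewrite mulrAC; apply: (subringM rD).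
Qed.

Lemma poly_denominator f : exists d, [/\ D d, d != 0 & forall k, D (d * f`_k)].
Proof.
have [d [Dd d0 sD]] := common_denominator f; exists d; split=> // k.
have [kf|fk] := ltnP k (size f); first by apply/sD/mem_nth.
by rewrite nth_default // mulr0; apply: (subring0 rD).
Qed.

(** A polynomial with coefficients in [D] is integer-valued on every overring, so one [d] serves all
    [A] at once. *)
Lemma IntE_denominator f : exists d, [/\ D d, d != 0
  & forall A, overring D A -> IntE A (embC d * emb f)].
Proof.
have [d [Dd d0 df]] := poly_denominator f; exists d; split=> // A [rA sDA].
exists (d *: f); rewrite embCZ; split=> //; apply: Int_coef => // k.
by rewrite coefZ; apply/sDA/df.
Qed.

Lemma overring_IntE_embC A d : overring D A -> D d -> IntE A (embC d).
Proof. by move=> [rA sDA] Dd; apply/(IntE_embC _ (subring0 rA)); apply: sDA. Qed.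

Lemma IntE_quotient_field A : overring D A ->
  forall x, exists a b, [/\ IntE A a, IntE A b, b != 0 & x = a / b].
Proof.
move=> oA x; have [f [g [g0 ->]]] := emb_frac x.
have [d [Dd d0 /(_ A oA) Af]] := IntE_denominator f.
have [e [De e0 /(_ A oA) Ag]] := IntE_denominator g.
have rI := subring_IntE oA.1; pose c : F := embC (d * e).
have c0 : c != 0 by rewrite embC_eq0 mulf_neq0.
have g0' : emb g != 0 by rewrite emb_eq0.
exists (c * emb f), (c * emb g); split.
- by rewrite /c embCM mulrAC mulrC; apply: (subringM rI) => //; apply: overring_IntE_embC.
- by rewrite /c embCM -mulrA; apply: (subringM rI) => //; apply: overring_IntE_embC.
- exact: mulf_neq0 c0 g0'.
by rewrite -mulf_div divff ?mul1r.
Qed.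

(* An invertible ideal of [Int(A)] becomes principal in the PID [K[X]]; after scaling it generates [K[X]] over [K], which is what [normal] says. *)
Definition normal (J : F -> Prop) : Prop :=
  (exists c, c != 0 /\ J (embC c)) /\ forall x, J x -> exists f, x = emb f.

(** Since [d J] lies in [K[X]], choose a nonzero [p] of least size with [p / d] in [J]. Division by
    [p] shows that it divides every numerator, so dividing [J] by [p / d] leaves polynomials only,
    among them [1]. *)
Lemma normalize A J : overring D A -> frac_ideal (IntE A) J ->
  exists h, h != 0 /\ normal (fun y => J (h * y)).
Proof.
move=> oA [[J0 JD JM] [x0 [Jx0 x0n]] [d [_ d0 dJ]]].
have dJP x : J x -> exists f, x = emb f / d.
  by move=> /dJ[f [_ def_f]]; exists f; rewrite -def_f mulrAC divff ?mul1r.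
have embM a x : D a -> J x -> J (embC a * x).
  by move=> Da; apply: JM; apply: overring_IntE_embC.
have [p [Jp p0 pmin]] : exists p, [/\ J (emb p / d), p != 0
    & forall q, J (emb q / d) -> q != 0 -> (size p <= size q)%N].
  have [f def_f] := dJP _ Jx0.
  have [n le_n] := ubnP (size f); elim: n f {Jx0} x0 x0n def_f le_n (Jx0) => // n IHn f x0 x0n def_f le_n Jx0.
  have [[q [Jq q0 qf]]|no] := classic (exists q, [/\ J (emb q / d), q != 0 & (size q < size f)%N]).
    apply: (IHn q (emb q / d)) => //; last exact: leq_trans qf le_n.
    by rewrite mulf_neq0 ?invr_eq0 // emb_eq0.
  exists f; rewrite -def_f; split=> //.
    by apply: contra_neq x0n; rewrite def_f => ->; rewrite rmorph0 mul0r.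
  by move=> q Jq q0; rewrite leqNgt; apply/negP=> qf; apply: no; exists q.
exists (emb p / d); split; first by rewrite mulf_neq0 ?invr_eq0 // emb_eq0.
split; first by exists 1; rewrite embC1 mulr1 oner_neq0.
move=> y /[dup] Jy /dJP[q def_y]; exists (q %/ p).
have p0' : emb p != 0 by rewrite emb_eq0.
(* Only [Int(A)] acts on [J], so the quotient is first multiplied by a constant [e]; this does not
   change the size of the remainder. *)
have [e [De e0 /(_ A oA) Ae]] := IntE_denominator (q %/ p).
have r0 : q %% p = 0.
  apply: contraTeq isT => r0; suff : (size p <= size (q %% p)%R)%N by rewrite leqNgt ltn_modp p0.
  rewrite -(size_scale (q %% p) e0); apply: pmin; last by rewrite scaler_eq0 negb_or e0.
  have -> : emb (e *: (q %% p)) / d =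
      embC e * (emb p / d * y) + (- (embC e * emb (q %/ p))) * (emb p / d).
    rewrite def_y -embCZ; have -> : q %% p = q - q %/ p * p by rewrite {2}(divp_eq q p) addrC addKr.
    by rewrite rmorphB rmorphM; field.
  apply: JD; first exact: embM.
  by apply: JM => //; apply: (subringN (subring_IntE oA.1)).
apply: (mulfI (x := emb p / d)); first by rewrite mulf_neq0 ?invr_eq0.
by rewrite def_y {1}(divp_eq q p) r0 addr0 rmorphM; field.
Qed.

(** Clearing the denominators of the factors from [J] in an expression of [1] in [J J'] yields a
    nonzero constant of [J']. Conversely a constant [c] of [J] gives [c J'] inside [Int(A)], so [J']
    consists of polynomials. *)
Lemma normal_inverse A J J' : overring D A -> inverse_pair (IntE A) J J' ->
  normal J -> normal J'.
Proof.
move=> oA [mJ [J'0 J'D J'M] JJ' one] [[c [c0 Jc]] JP]; split.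
  suff [c' [_ c'0 J'c']] : exists c', [/\ D c', c' != 0 & J' (embC c' * 1)].
    by exists c'; rewrite mulr1 in J'c'.
  apply: (prodset_ind (P := fun x => exists a, [/\ D a, a != 0 & J' (embC a * x)]) _ _ _ one).
  - by exists 1; rewrite mulr0 oner_neq0; split=> //; apply: (subring1 rD).
  - move=> x y [a [Da a0 J'a]] [b [Db b0 J'b]]; exists (a * b).
    split; [exact: (subringM rD)|exact: mulf_neq0|].
    rewrite mulrDr {1}[a * b]mulrC !embCM -!mulrA.
    by apply: J'D; apply: J'M => //; apply: overring_IntE_embC.
  move=> x y /JP[f ->] J'y; have [e [De e0 /(_ A oA) Ae]] := IntE_denominator f.
  by exists e; rewrite mulrA; split=> //; apply: J'M.
move=> y J'y; have [f [_ def_f]] := JJ' _ _ Jc J'y.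
by exists (c^-1 *: f); rewrite -embCZ -def_f mulrA -embCM mulVf // embC1 mul1r.
Qed.

(** The normalizing scalar is moved to the inverse: [M] is [J] divided by [h], and [M'] is [J']
    multiplied by [h]. *)
Lemma normal_form A J : overring D A -> invertible (IntE A) J ->
  exists h M M', [/\ h != 0, inverse_pair (IntE A) M M', normal M, normal M'
    & forall y, M y <-> J (h * y)].
Proof.
move=> oA iJ; have rI := subring_IntE oA.1.
have [fJ _] := iJ; have [h [h0 nM]] := normalize oA fJ.
have [J' [mJ mJ' JJ' one]] := invertible_inverse_pair rI iJ.
have pM : inverse_pair (IntE A) (fun y => J (h * y)) (fun y => J' (h^-1 * y)).
  split.
  - exact: submodule_preim.
  - exact: submodule_preim.
  - by move=> x y Jx Jy; rewrite (_ : x * y = h * x * (h^-1 * y)); [apply: JJ'|field].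
  move: one; apply: prodset_ind; [exact: prodset0|exact: prodsetD|move=> x y Jx Jy].
  have -> : x * y = (x / h) * (h * y) by field.
  by apply: prodset_mul; rewrite ?mulKf // mulrC divfK.
by exists h, (fun y => J (h * y)), (fun y => J' (h^-1 * y)); split=> //; apply: normal_inverse pM _.
Qed.

(** The numerator of a constant in [J] is again in [J]. Local finiteness speaks of elements of [D],
    hence this form. *)
Lemma normalD A J : overring D A -> submodule (IntE A) J -> normal J ->
  exists c, [/\ D c, c != 0 & J (embC c)].
Proof.
move=> oA [_ _ JM] [[c [c0 Jc]] _]; have [a [b [Da Db b0 def_c]]] := qD.2 c.
exists a; split=> //; first by apply: contra_neq c0; rewrite def_c => ->; rewrite mul0r.
have -> : a = b * c by rewrite def_c mulrC divfK.
by rewrite embCM; apply: JM => //; apply: overring_IntE_embC.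
Qed.

(* Induction on the degree: [s ^ n * f(t) - f(s t)] is the value at [t] of an integer-valued polynomial of smaller degree, so [s ^ n * f(t)] lies in [A] for all [s] in [(D : t)]; by flatness these [s] generate [A]. *)
Lemma Int_flat A f : overring D A ->
  (forall t, A t -> prodset (fun d => D d /\ D (d * t)) A 1) -> Int D f -> Int A f.
Proof.
move=> [rA sDA] flatA; have [n] := ubnP (size f).
elim: n f => // n IHn f lefn Df t At.
pose B (b : K) := A b /\ A (b * f.[t]).
apply: (_ : B 1 -> A f.[t]) => [[_]|]; first by rewrite mul1r.
have mB : submodule A B.
  split; first by split; rewrite ?mul0r; apply: (subring0 rA).
    by move=> x y [Ax Axf] [Ay Ayf]; split; rewrite ?mulrDl; apply: (subringD rA).
  by move=> a x Aa [Ax Axf]; split; rewrite -?mulrA; apply: (subringM rA).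
apply: (radical_proper rA mB _ (flatA t At)) => s [Ds Dst].
split; first exact: sDA.
case: n => [|n] in IHn lefn *.
  by exists 0%N; move: lefn; rewrite /B ltnS leqn0 size_poly_eq0 expr0 => /eqP->;
    split; rewrite ?horner0 ?mulr0; [apply: (subring1 rA)|apply: (subring0 rA)].
exists n; split; first by apply: (subringX rA); apply: sDA.
(* This is [s ^ n f(X) - f(s X)]; its coefficient of index [n] vanishes, so the polynomial stops
   before [n] and the induction applies. *)
pose g := \poly_(k < n) (f`_k * (s ^+ n - s ^+ k)).
have gE (z : K) : g.[z] = s ^+ n * f.[z] - f.[s * z].
  rewrite horner_poly !(horner_coef_wide _ (lefn : size f <= n.+1)%N).
  rewrite !big_ord_recr /= mulrDr mulr_sumr opprD addrACA -sumrB.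
  rewrite exprMn [X in _ = _ + X](_ : _ = 0) ?addr0; last by ring.
  by apply: eq_bigr => k _; rewrite exprMn; ring.
have Dg : Int D g.
  move=> a Da; rewrite gE; apply: (subringB rD).
    by apply: (subringM rD); [apply: (subringX rD)|apply: Df].
  by apply: Df; apply: (subringM rD).
have Ag : A g.[t] by apply: IHn => //; rewrite ltnS size_poly.
have -> : s ^+ n * f.[t] = g.[t] + f.[s * t] by rewrite gE subrK.
by apply: (subringD rA) => //; apply/sDA/Df.
Qed.

End QuotientField.

(** * Testing membership locally over a Jaffard family *)

Section Jaffard.
Variables (D : K -> Prop) (I : Type) (T : I -> K -> Prop).
Hypothesis qD : quotient_field_of D.
Hypothesis jT : jaffard D T.

Let rD : subring D. Proof. by case: qD. Qed.
Let oT i : overring D (T i). Proof. by have [[]] := jT. Qed.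
Let rT i : subring (T i). Proof. by case: (oT i). Qed.
Let sDT i a : D a -> T i a. Proof. by case: (oT i) => _; apply. Qed.
Let rID : subring (IntE D). Proof. exact: subring_IntE. Qed.
Let rIT i : subring (IntE (T i)). Proof. exact: subring_IntE. Qed.
Let oD : overring D D. Proof. by []. Qed.

(* [J T_i] described by denominators: [x] lies in it as soon as the [d] in [D] with [d x] in [J] generate the unit ideal of [T_i]. *)
Definition loc i (J : F -> Prop) x := prodset (fun d => D d /\ J (embC d * x)) (T i) 1.

Lemma comax_mono i (A B : K -> Prop) : (forall d, A d -> B d) ->
  prodset A (T i) 1 -> prodset B (T i) 1.
Proof. by move=> sAB; apply: prodset_mono. Qed.

Lemma comax_mul i (A B C : K -> Prop) : (forall a b, A a -> B b -> C (a * b)) ->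
  prodset A (T i) 1 -> prodset B (T i) 1 -> prodset C (T i) 1.
Proof.
move=> ABC A1 B1; rewrite -[1]mulr1; apply: prodset_mul2 A1 B1 => //.
exact: subringM.
Qed.

(** Completeness: [A] is the intersection of its extensions to the [T i], each of which contains
    [1]. *)
Lemma comax_global (A : K -> Prop) : ideal D A -> (forall i, prodset A (T i) 1) -> A 1.
Proof. by move=> iA A1; have [[_ [_ [_ [_ [comp _]]]]] _] := jT; apply/(comp A iA). Qed.

(** With [t = a / b], apply flatness to the relation [b t - a 1 = 0]. The resulting [c] satisfy
    [b c_0l = a c_1l], so each [c_1l t = c_0l] is in [D], while [1] is a combination of the [c_1l]
    over [T i]. *)
Lemma comax_flat i t : T i t -> prodset (fun d => D d /\ D (d * t)) (T i) 1.
Proof.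
move=> Tt; have [[_ [_ [_ [flat _]]]] _] := jT.
have [a [b [Da Db b0 def_t]]] := qD.2 t.
pose u (k : 'I_2) := if k == ord0 then b else - a.
pose v (k : 'I_2) := if k == ord0 then t else 1.
have [|||m [c [y [Dc Ty def_v uc]]]] := flat i 2 u v.
- by move=> k; rewrite /u; case: ifP => // _; apply: (subringN rD).
- by move=> k; rewrite /v; case: ifP => // _; apply: (subring1 (rT i)).
- by rewrite big_ord_recl big_ord1 /u /v /= def_t; field.
have -> : 1 = \sum_l c ord_max l * y l by rewrite -def_v.
apply: (big_ind (prodset _ (T i))) => [|x z|l _]; [exact: prodset0|exact: prodsetD|].
apply: prodset_mul => //; split=> //.
suff -> : c ord_max l * t = c ord0 l by [].
have := uc l; rewrite big_ord_recl big_ord1 /u /= (_ : lift ord0 ord0 = ord_max); last exact: val_inj.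
move=> bc; apply: (mulfI b0); rewrite def_t; apply/eqP; rewrite -subr_eq0 -oppr_eq0 -[X in _ == X]bc.
by apply/eqP; field.
Qed.

(* Flatness gives [(c T_j \cap D) T_i = c T_j T_i \cap T_i], and [T_j T_i = K]. *)
Lemma comax_indep i j c : i <> j -> c != 0 ->
  prodset (fun d => D d /\ exists u, T j u /\ d = c * u) (T i) 1.
Proof.
move=> neq_ij c0; have [[_ [_ [_ [flat [_ [indep _]]]]]] _] := jT.
have [s [sT def_c]] := indep i j neq_ij c^-1.
have {}sT k : (k < size s)%N -> T i (nth (0, 0) s k).1 /\ T j (nth (0, 0) s k).2.
  by move=> ks; apply/sT/In_mem/mem_nth.
move: def_c; rewrite (big_nth (0, 0)) big_mkord => def_c.
have [e [De e0 es]] := common_denominator qD [seq c * p.2 | p <- s].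
(* Write the inverse of [c] as a sum of [p_k q_k] with [p_k] in [T i] and [q_k] in [T j]. The
   relation given to flatness is [e 1 - sum (e c q_k) p_k = 0], its coefficients put into [D] by
   [e]. *)
pose a (k : 'I_(size s).+1) :=
  if unlift ord0 k is Some l then - (e * (c * (nth (0, 0) s l).2)) else e.
pose t (k : 'I_(size s).+1) :=
  if unlift ord0 k is Some l then (nth (0, 0) s l).1 else 1.
have [|||m [b [y [Db Ty def_t ab]]]] := flat i _ a t.
- move=> k; rewrite /a; case: unliftP => [l _|//]; apply: (subringN rD); apply: es.
  by apply/mapP; exists (nth (0, 0) s l); rewrite ?mem_nth.
- move=> k; rewrite /t; case: unliftP => [l _|_]; last exact: subring1 (rT i).
  by have [] := sT l (ltn_ord l).
- rewrite big_ord_recl /a /t unlift_none mulr1.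
  under eq_bigr => k _ do rewrite liftK.
  rewrite (eq_bigr (fun k : 'I_(size s) => - (e * c) * ((nth (0, 0) s k).1 * (nth (0, 0) s k).2))).
    by rewrite -mulr_sumr -def_c; field.
  by move=> k _; ring.
have -> : 1 = \sum_l b ord0 l * y l by rewrite -def_t /t unlift_none.
apply: (big_ind (prodset _ (T i))) => [|x z|l _]; [exact: prodset0|exact: prodsetD|].
apply: prodset_mul => //; split=> //.
(* Cancelling [e] in the relation for the [b k l] leaves [b_0l = c sum q_k b_kl], the required
   multiple of [c]. *)
exists (\sum_(k < size s) (nth (0, 0) s k).2 * b (lift ord0 k) l); split.
  apply: (subring_sum (rT j)) => k; apply: (subringM (rT j)); last exact: sDT.
  by have [] := sT k (ltn_ord k).
apply: (mulfI e0); have := ab l; rewrite big_ord_recl /a unlift_none.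
under eq_bigr => k _ do rewrite liftK mulNr.
rewrite sumrN => /eqP; rewrite subr_eq0 => /eqP->.
by rewrite !mulr_sumr; apply: eq_bigr => k _; ring.
Qed.

(** * Localizing and gluing ideals of rings of integer-valued polynomials *)

Lemma IntE_sub i x : IntE D x -> IntE (T i) x.
Proof.
by move=> [f [Df ->]]; exists f; split=> //; apply: (Int_flat qD (oT i)) => // t; apply: comax_flat.
Qed.

Lemma embC_IntE i a : T i a -> IntE (T i) (embC a).
Proof. by move=> Ta; apply/IntE_embC => //; apply: subring0. Qed.

Lemma embC_IntD a : D a -> IntE D (embC a).
Proof. exact: overring_IntE_embC. Qed.

Lemma loc_mono i (J M : F -> Prop) x : (forall y, J y -> M y) -> loc i J x -> loc i M x.
Proof. by move=> sJM; apply: comax_mono => d [Dd /sJM]. Qed.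

Lemma loc_mul i (J M N : F -> Prop) x y : (forall u v, J u -> M v -> N (u * v)) ->
  loc i J x -> loc i M y -> loc i N (x * y).
Proof.
move=> JMN; apply: comax_mul => a b [Da Jax] [Db Mby]; split; first exact: (subringM rD).
by rewrite embCM mulrACA; apply: JMN.
Qed.

Lemma loc_sub i J x : J x -> loc i J x.
Proof.
move=> Jx; rewrite /loc -[X in prodset _ _ X]mulr1; apply: prodset_mul; last exact: (subring1 (rT i)).
by rewrite embC1 mul1r; split=> //; apply: (subring1 rD).
Qed.

Lemma loc_submodule i J : submodule (IntE D) J -> submodule (IntE D) (loc i J).
Proof.
move=> [J0 JD JM]; split; first exact: loc_sub.
  move=> x y; apply: comax_mul => a b [Da Jax] [Db Jby]; split; first exact: (subringM rD).
  rewrite mulrDr embCM; apply: JD; first by rewrite [embC a * _]mulrC -mulrA; apply: JM => //; apply: embC_IntD.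
  by rewrite -mulrA; apply: JM => //; apply: embC_IntD.
by move=> a x Ia; apply: comax_mono => d [Dd Jdx]; split=> //; rewrite mulrCA; apply: JM.
Qed.

(** The [d] in [D] with [d x] in [J] form an ideal of [D] that becomes the unit ideal in every
    [T i]; hence [1] is one of them. *)
Lemma loc_global J x : submodule (IntE D) J -> (forall i, loc i J x) -> J x.
Proof.
move=> [J0 JD JM] /comax_global; rewrite embC1 mul1r; case=> //.
split; last by move=> d [].
split; first by rewrite embC0 mul0r; split=> //; apply: (subring0 rD).
  move=> a b [Da Jax] [Db Jbx]; split; first exact: (subringD rD).
  by rewrite embCD mulrDl; apply: JD.
move=> a b Da [Db Jbx]; split; first exact: (subringM rD).
by rewrite embCM -mulrA; apply: JM => //; apply: embC_IntD.
Qed.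

(** If [1 = sum d t] with every [d x] in [J], then [x = sum t (d x)]. *)
Lemma loc_le i J M x : submodule (IntE (T i)) M -> (forall y, J y -> M y) ->
  loc i J x -> M x.
Proof.
move=> [M0 MD MM] sJM Jx; rewrite -[x]mul1r -embC1.
move: Jx; apply: (prodset_ind (P := fun a => M (embC a * x))).
- by rewrite embC0 mul0r.
- by move=> a b; rewrite embCD mulrDl; apply: MD.
move=> d t [_ /sJM Mdx] Tt; rewrite embCM [embC d * _]mulrC -mulrA.
by apply: MM => //; apply: embC_IntE.
Qed.

(** A denominator [d] is needed that brings [x] into all [L j] at once. Local finiteness leaves
    finitely many [j] to treat, independence treats each of them, and denominators for different [j]
    are multiplied. *)
Lemma loc_glue (L : I -> F -> Prop) (s : seq I) :
  (forall j, submodule (IntE (T j)) (L j)) -> (forall j, normal (L j)) ->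
  (forall j, ~ List.In j s -> forall x, IntE (T j) x -> L j x) ->
  forall i x, L i x -> loc i (fun y => forall j, L j y) x.
Proof.
move=> mL nL LT i x Lx; have [f def_x] := (nL i).2 x Lx.
have [e [De e0 Ief]] := IntE_denominator qD f.
have [s' s'P] := jT.2 e De e0.
(* For [j] outside [s ++ s'] the clearing constant [e] is a unit of [T j], so [x] already lies in
   [Int(T j)], hence in [L j], and any [d] in [D] will do. *)
suff: prodset (fun d => D d /\ forall j, List.In j (s ++ s') -> L j (embC d * x)) (T i) 1.
  apply: comax_mono => d [Dd Ldx]; split=> // j.
  have [/Ldx//|js] := classic (List.In j (s ++ s')).
  have [_ _ LM] := mL j; apply: LM; first exact/embC_IntE/sDT.
  apply: LT => [js'|]; first by apply: js; apply/List.in_app_iff; left.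
  have [[u [Tu eu1]]|nu] := classic (is_unit_in (T j) e); last first.
    by case: js; apply/List.in_app_iff; right; apply: s'P.
  have -> : x = embC u * (embC e * emb f) by rewrite def_x mulrA -embCM mulrC -[u * e]mulrC eu1 embC1 mulr1.
  by apply: (subringM (rIT j)); [apply: embC_IntE|apply: Ief].
elim: (s ++ s') => [|j r IHr].
  rewrite -[X in prodset _ _ X]mulr1; apply: prodset_mul; last exact: (subring1 (rT i)).
  by split=> //; apply: (subring1 rD).
have {IHr} : prodset (fun d => D d /\ L j (embC d * x)) (T i) 1 ->
    prodset (fun d => D d /\ forall k, List.In k (j :: r) -> L k (embC d * x)) (T i) 1.
  move=> Lj; apply: comax_mul Lj IHr => a b [Da Lax] [Db Lbx]; split; first exact: (subringM rD).
  move=> k [<-|/Lbx Lkx]; rewrite embCM.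
    by rewrite [embC a * _]mulrC -mulrA; have [_ _] := mL j; apply=> //; apply/embC_IntE/sDT.
  by rewrite -mulrA; have [_ _] := mL k; apply=> //; apply/embC_IntE/sDT.
apply; have [_ LD LM] := mL j.
have [<-|neq_ij] := classic (i = j); first exact: loc_sub.
(* For [j] other than [i], take [d = e c u] with [c] a constant of [L j] and [u] in [T j]: then
   [d x = u (e x) c] is in [L j]. *)
have [[c [c0 Lc]] _] := nL j.
have := comax_indep neq_ij (mulf_neq0 e0 c0); apply: comax_mono => d [Dd [u [Tu def_d]]].
split=> //; have -> : embC d * x = embC u * (embC e * emb f) * embC c.
  by rewrite def_d !embCM def_x; ring.
by apply: LM => //; apply: (subringM (rIT j)); [apply: embC_IntE|apply: Ief].
Qed.

(** Completeness for the ideal [D] itself makes [D] the intersection of the [T j]. The index [i]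
    provides the polynomial. *)
Lemma IntE_bigcap (i : I) x : (forall j, IntE (T j) x) -> IntE D x.
Proof.
move=> Ix; have [f [_ def_x]] := Ix i; exists f; split=> // a Da.
have [[_ [_ [_ [_ [comp _]]]]] _] := jT.
apply/(comp D); first by split=> //; apply: subring_submodule.
move=> j; rewrite -[f.[a]]mul1r; apply: prodset_mul; first exact: (subring1 rD).
by have := Ix j; rewrite def_x => /IntE_emb; apply=> //; apply: sDT.
Qed.

Lemma normal_IntE A : subring A -> normal (IntE A).
Proof.
move=> rA; split; last by move=> _ [f [_ ->]]; exists f.
by exists 1; split; [apply: oner_neq0|apply/IntE_embC; [apply: subring0|apply: subring1]].
Qed.

(** Gluing the family of all [Int(T j)], with empty exceptional list, identifies [Int(T i)] with the
    localization of [Int(D)]. *)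
Lemma loc_IntE i x : IntE (T i) x -> loc i (IntE D) x.
Proof.
move=> Ix; apply: (loc_mono (J := fun y => forall j, IntE (T j) y)).
  by move=> y; apply: IntE_bigcap.
apply: (loc_glue (L := fun j => IntE (T j)) (s := [::])) => // j.
  exact: subring_submodule.
exact: normal_IntE.
Qed.

(** Elements of [Int(T i)] have denominators into [Int(D)], so their products with [J] have
    denominators into [J]. Conversely [x = sum (d x) t], with each [t] a constant of [Int(T i)]. *)
Lemma prodset_loc i J x : submodule (IntE D) J -> prodset J (IntE (T i)) x <-> loc i J x.
Proof.
move=> mJ; split.
  have [L0 LD _] := loc_submodule i mJ; move: x; apply: prodset_ind => // x y Jx Iy.
  apply: loc_mul (loc_sub _ Jx) (loc_IntE Iy) => u v Ju Iv.
  by rewrite mulrC; have [_ _] := mJ; apply.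
move=> Jx; rewrite -[x]mul1r -embC1.
move: Jx; apply: (prodset_ind (P := fun a => prodset J (IntE (T i)) (embC a * x))).
- by rewrite embC0 mul0r; apply: prodset0.
- by move=> a b; rewrite embCD mulrDl; apply: prodsetD.
by move=> d t [_ Jdx] Tt; rewrite embCM mulrAC; apply: prodset_mul => //; apply: embC_IntE.
Qed.

(** * The two maps of the sequence *)

Definition extE (J : K -> Prop) : F -> Prop :=
  prodset (fun y => exists a, J a /\ y = embC a) (IntE D).

Lemma extE_inverse_pair J J' : inverse_pair D J J' ->
  inverse_pair (IntE D) (extE J) (extE J').
Proof.
move=> [mJ mJ' JJ' one]; have mI := subring_submodule rID.
split; [exact: prodset_submoduler|exact: prodset_submoduler| |].
- move=> x y xP yP; have : prodset (IntE D) (IntE D) (x * y).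
    apply: prodset_mul2 xP yP; first exact: (subringM rID).
    move=> _ _ [a [Ja ->]] [b [Jb ->]]; rewrite -embCM; apply: embC_IntD; exact: JJ'.
  by apply: (prodset_le mI); apply: (subringM rID).
rewrite -embC1; move: one.
apply: (prodset_ind (P := fun a => prodset (extE J) (extE J') (embC a))).
- by rewrite embC0; apply: prodset0.
- by move=> a b; rewrite embCD; apply: prodsetD.
move=> a b Ja Jb; rewrite embCM; apply: prodset_mul; rewrite -[embC _]mulr1.
  by apply: prodset_mul; [exists a|apply: (subring1 rID)].
by apply: prodset_mul; [exists b|apply: (subring1 rID)].
Qed.

Lemma IntE_invertible A J J' : overring D A -> inverse_pair (IntE A) J J' ->
  invertible (IntE A) J.
Proof.
move=> oA; have rI := subring_IntE oA.1.
exact: (inverse_pair_invertible rI (IntE_quotient_field qD oA)).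
Qed.

Lemma extE_invertible J : invertible D J -> invertible (IntE D) (extE J).
Proof.
move=> /(invertible_inverse_pair rD)[J' pJ].
exact: IntE_invertible oD (extE_inverse_pair pJ).
Qed.

Lemma extE_same_class J1 J2 : same_class J1 J2 -> same_class (extE J1) (extE J2).
Proof.
move=> [a [a0 J12]]; apply: prodset_same_class; exists (embC a); rewrite embC_eq0.
split=> // x; split=> [[_ [/J12[b [Jb ->]] ->]]|[_ [[b [Jb ->]] ->]]].
  by exists (embC b); rewrite embCM; split=> //; exists b.
by exists (a * b); rewrite embCM; split=> //; apply/J12; exists b.
Qed.

Lemma local_invertible i J : invertible (IntE D) J ->
  invertible (IntE (T i)) (prodset J (IntE (T i))).
Proof.
move=> /(invertible_inverse_pair rID)[J' pJ]; apply: (IntE_invertible (oT i)).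
by apply: inverse_pair_ext pJ => //; apply: IntE_sub.
Qed.

(** After scaling, [M] and its inverse contain constants [c] and [c'] of [D]. Wherever both are
    units of [T i], the extension of [M] is [Int(T i)], so [h] generates that of [J]. *)
Lemma local_principal_cofinite J : invertible (IntE D) J ->
  exists s : seq I, forall i, ~ List.In i s -> principal (IntE (T i)) (prodset J (IntE (T i))).
Proof.
move=> iJ; have [h [M [M' [h0 pM nM nM' MJ]]]] := normal_form qD oD iJ.
have [mM mM' MM' _] := pM.
have [c [Dc c0 Mc]] := normalD qD oD mM nM.
have [c' [Dc' c'0 M'c']] := normalD qD oD mM' nM'.
have [s sP] := jT.2 c Dc c0; have [s' s'P] := jT.2 c' Dc' c'0.
exists (s ++ s') => i iss; exists h; split=> // x.
have [u [Tu cu]] : is_unit_in (T i) c.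
  by apply: NNPP => /sP si; apply: iss; apply/List.in_app_iff; left.
have [u' [Tu' cu']] : is_unit_in (T i) c'.
  by apply: NNPP => /s'P si; apply: iss; apply/List.in_app_iff; right.
split.
  move: x; apply: (prodset_le (submodule_scale h (subring_submodule (rIT i)))).
  move=> x y Jx Iy; exists (x / h * y); rewrite mulrA [h * _]mulrC divfK //; split=> //.
  apply: (subringM (rIT i)) => //.
  have Mx : M (x / h) by apply/MJ; rewrite mulrC divfK.
  have -> : x / h = embC u' * (x / h * embC c').
    by rewrite mulrCA -embCM [u' * _]mulrC cu' embC1 mulr1.
  by apply: (subringM (rIT i)); [apply: embC_IntE|apply: IntE_sub; apply: MM'].
move=> [y [Iy ->]]; have -> : h * y = h * embC c * (embC u * y).
  by rewrite -[LHS]mulr1 -embC1 -cu embCM; ring.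
apply: prodset_mul; first exact/MJ.
by apply: (subringM (rIT i)) => //; apply: embC_IntE.
Qed.

(** * Exactness at the Picard groups of [D] and of [Int(D)] *)

(** Evaluation at [0] sends the extension of [J] back into [J]. A generator is thus a polynomial [p]
    with [p(0)] in [J], and [b = p f] evaluates to [b = p(0) f(0)] for [b] in [J]. *)
Lemma extE_principal (J : K -> Prop) : (exists a, J a /\ a != 0) -> submodule D J ->
  principal (IntE D) (extE J) -> principal D J.
Proof.
move=> [a [Ja a0]] [J0 JD JM] [x [x0 JxI]].
have val0 y : extE J y -> exists f, y = emb f /\ J f.[0].
  move: y; apply: prodset_ind.
  - by exists 0; rewrite rmorph0 horner0.
  - by move=> _ _ [f [-> Jf]] [g [-> Jg]]; exists (f + g); rewrite rmorphD hornerD; split=> //; apply: JD.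
  move=> _ _ [b [Jb ->]] [f [Df ->]]; exists (b *: f); rewrite embCZ hornerZ mulrC; split=> //.
  by apply: JM => //; apply: Df; apply: (subring0 rD).
have [p [def_x Jp]] : exists f, x = emb f /\ J f.[0].
  by apply/val0/JxI; exists 1; rewrite mulr1; split=> //; apply: (subring1 rID).
have Jp0 b : J b -> exists d, D d /\ b = p.[0] * d.
  move=> Jb; have : extE J (embC b).
    by rewrite -[embC b]mulr1; apply: prodset_mul; [exists b|apply: (subring1 rID)].
  move=> /JxI[_ [[f [Df ->]]]]; rewrite def_x -rmorphM => /emb_inj def_b.
  exists f.[0]; split; first by apply: Df; apply: (subring0 rD).
  by rewrite -hornerM -def_b hornerC.
exists p.[0]; split.
  by have [d [_ def_a]] := Jp0 a Ja; apply: contra_neq a0; rewrite def_a => ->; rewrite mul0r.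
by move=> b; split=> [/Jp0//|[d [Dd ->]]]; rewrite mulrC; apply: JM.
Qed.

(** A generator of [J T_i], viewed as a constant polynomial, still generates after extension; so the
    composite of the two maps is trivial. *)
Lemma extE_local_principal i J : principal (T i) (prodset J (T i)) ->
  principal (IntE (T i)) (prodset (extE J) (IntE (T i))).
Proof.
move=> [a [a0 JaT]]; exists (embC a); rewrite embC_eq0; split=> // x.
have mI := subring_submodule (rIT i); have mS := submodule_scale (embC a) mI; split.
  move: x; apply: (prodset_le mS) => x y + Iy; rewrite mulrC.
  move: x; apply: (prodset_le (submodule_preim y (submodule_sub (@IntE_sub i) mS))).
  move=> _ z [b [Jb ->]] Iz; have /JaT[t [Tt ->]] : prodset J (T i) b.
    by rewrite -[b]mulr1; apply: prodset_mul => //; apply: (subring1 (rT i)).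
  exists (y * (embC t * z)); rewrite embCM; split; last by ring.
  apply: (subringM (rIT i)) => //; apply: (subringM (rIT i)); first exact: embC_IntE.
  exact: IntE_sub.
move=> [y [Iy ->]]; have : prodset J (T i) a.
  by apply/JaT; exists 1; rewrite mulr1; split=> //; apply: (subring1 (rT i)).
apply: (prodset_ind (P := fun b => prodset (extE J) (IntE (T i)) (embC b * y))).
- by rewrite embC0 mul0r; apply: prodset0.
- by move=> u v; rewrite embCD mulrDl; apply: prodsetD.
move=> b t Jb Tt; rewrite embCM -mulrA; apply: prodset_mul.
  by rewrite -[embC b]mulr1; apply: prodset_mul; [exists b|apply: (subring1 rID)].
by apply: (subringM (rIT i)) => //; apply: embC_IntE.
Qed.

(* A generator of [M Int(T_i)] also generates [M K[X] = K[X]], hence is a constant. *)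
Lemma normal_local_generator i M M' : inverse_pair (IntE D) M M' -> normal M ->
  principal (IntE (T i)) (prodset M (IntE (T i))) ->
  exists u : K, [/\ u != 0, forall m, M m -> exists z, IntE (T i) z /\ m = embC u * z,
    loc i M (embC u) & loc i M' (embC u^-1)].
Proof.
move=> [mM mM' MM' one] [[c [c0 Mc]] MP] [y [y0 My]].
have M_le m : M m -> exists z, IntE (T i) z /\ m = y * z.
  by move=> Mm; apply/My; rewrite -[m]mulr1; apply: prodset_mul => //; apply: (subring1 (rIT i)).
have yM : prodset M (IntE (T i)) y.
  by apply/My; exists 1; rewrite mulr1; split=> //; apply: (subring1 (rIT i)).
have [p def_y] : exists p : {poly K}, y = emb p.
  move: (y) yM; apply: prodset_ind.
  - by exists 0; rewrite rmorph0.
  - by move=> _ _ [f ->] [g ->]; exists (f + g); rewrite rmorphD.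
  by move=> _ _ /MP[f ->] [g [_ ->]]; exists (f * g); rewrite rmorphM.
have [u def_p] : exists u, p = u%:P.
  have [_ [[f [_ ->]]]] := M_le _ Mc; rewrite def_y -rmorphM => /emb_inj def_c.
  have p0 : p != 0 by apply: contra_neq y0; rewrite def_y => ->; rewrite rmorph0.
  have f0 : f != 0 by apply: contraTneq c0 => f0; rewrite -polyC_eq0 def_c f0 mulr0 eqxx.
  have := size_polyC c; rewrite def_c c0 size_mul // => sz.
  exists p`_0; apply: size1_polyC; move: sz f0; rewrite -size_poly_gt0.
  by case: (size f) => // n; rewrite addnS /= => <- _; rewrite leq_addr.
rewrite def_p -/(embC u) in def_y; subst y.
exists u; split=> //; first by rewrite -embC_eq0.
  exact/prodset_loc.
(* Divide an expression [1 = sum x y] over [M] and [M'] by [u]: each [x] is [u z] with [z] in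
   [Int(T i)], so each term becomes [y z]. *)
apply/prodset_loc => //; rewrite embCV -[_^-1]mul1r.
move: one; apply: (prodset_ind (P := fun z => prodset M' (IntE (T i)) (z / embC u))).
- by rewrite mul0r; apply: prodset0.
- by move=> x y; rewrite mulrDl; apply: prodsetD.
move=> x y /M_le[z [Iz ->]] M'y; have -> : embC u * z * y / embC u = y * z by field.
exact: prodset_mul.
Qed.

(** With [M] the normal form of [J], the ideal sought is the set [J1] of constants of [M], with
    inverse the constants of [M']. The constant local generators [u] make every required equality
    checkable over each [T i]. *)
Lemma local_principal_ext J : invertible (IntE D) J ->
  (forall i, principal (IntE (T i)) (prodset J (IntE (T i)))) ->
  exists J1, in_PicTheta D T J1 /\ same_class J (extE J1).
Proof.
move=> iJ Jprinc; have [h [M [M' [h0 pM nM nM' MJ]]]] := normal_form qD oD iJ.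
have [[M0 MD MM] [M'0 M'D M'M] MM' one] := pM.
have Mprinc i : principal (IntE (T i)) (prodset M (IntE (T i))).
  have [h1 [h10 MJ1]] : same_class (prodset M (IntE (T i))) (prodset J (IntE (T i))).
    apply: prodset_same_class; exists h^-1; rewrite invr_eq0; split=> // x; split.
      by move=> /MJ Jx; exists (h * x); rewrite mulKf.
    by move=> [y [Jy ->]]; apply/MJ; rewrite mulVKf.
  have [x [x0 Jx]] := Jprinc i; exists (h1 * x); split; first exact: mulf_neq0.
  move=> y; split=> [/MJ1[_ [/Jx[a [Ia ->]] ->]]|[a [Ia ->]]].
    by exists a; rewrite mulrA.
  by apply/MJ1; exists (x * a); rewrite mulrA; split=> //; apply/Jx; exists a.
pose J1 a := M (embC a); pose J1' a := M' (embC a).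
have gen i := normal_local_generator pM nM (Mprinc i).
have mJ1 : submodule D J1.
  split; first by rewrite /J1 embC0.
    by move=> a b; rewrite /J1 embCD; apply: MD.
  by move=> a b Da; rewrite /J1 embCM; apply/MM/embC_IntD.
have pJ1 : inverse_pair D J1 J1'.
  split=> //.
  - split; first by rewrite /J1' embC0.
      by move=> a b; rewrite /J1' embCD; apply: M'D.
    by move=> a b Da; rewrite /J1' embCM; apply/M'M/embC_IntD.
  - move=> a b Ja J'b; apply/IntE_embC; first exact: (subring0 rD).
    by rewrite embCM; apply: MM'.
  apply: (comax_global (A := fun d => D d /\ prodset J1 J1' d) _ _).2.
    have [P0 PD PM] := prodset_submodulel J1' mJ1.
    split; last by move=> d [].
    split; first by split=> //; apply: (subring0 rD).
      by move=> x y [Dx Px] [Dy Py]; split; [apply: (subringD rD)|apply: PD].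
    by move=> a x Da [Dx Px]; split; [apply: (subringM rD)|apply: PM].
  (* Locally [1 = u u^-1]: denominators [a] and [b] put [a u] into [J1] and [b u^-1] into [J1']. *)
  move=> i; have [u [u0 _ lu lu']] := gen i.
  apply: comax_mul lu lu' => a b [Da Ma] [Db Mb]; split; first exact: (subringM rD).
  have -> : a * b = (a * u) * (b * u^-1) by field.
  by apply: prodset_mul; rewrite /J1 /J1' embCM.
exists J1; split.
  split; first exact: inverse_pair_invertible rD qD.2 pJ1.
  (* The same [u] generates [J1 T_i]: a constant of [M] divided by [u] is a constant of [Int(T i)],
     hence in [T i]; conversely, the multiples [d u] in [J1] recover [u]. *)
  move=> i; have [u [u0 Mu lu _]] := gen i; exists u; split=> // a; split.
    move: a; apply: (prodset_le (submodule_scale u (subring_submodule (rT i)))).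
    move=> a t /Mu[g [Ig def_a]] Tt; exists (a / u * t); split; last by field.
    apply: (subringM (rT i)) => //; apply/IntE_embC; first exact: (subring0 (rT i)).
    have -> : embC (a / u) = g; last by [].
    by apply: (mulfI (x := embC u)); rewrite ?embC_eq0 // -embCM -def_a; congr embC; field.
  move=> [t [Tt ->]]; rewrite -[u]mul1r.
  move: lu; apply: (prodset_ind (P := fun z => prodset J1 (T i) (z * u * t))).
  - by rewrite !mul0r; apply: prodset0.
  - by move=> x y; rewrite !mulrDl; apply: prodsetD.
  move=> d s [_ Mdu] Ts; have -> : d * s * u * t = d * u * (s * t) by ring.
  by apply: prodset_mul; [rewrite /J1 embCM|apply: (subringM (rT i))].
exists h; split=> // x; split=> [Jx|[m [extm ->]]]; last first.
  apply/MJ; move: m extm; apply: prodset_ind => // _ y [a [Ma ->]] Iy.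
  by rewrite mulrC; apply: MM.
exists (x / h); split; last by rewrite mulrC divfK.
have Mx : M (x / h) by apply/MJ; rewrite mulrC divfK.
apply: loc_global => [|i]; first exact/prodset_submoduler/subring_submodule.
(* Locally [x / h = u g], where [u] comes from [J1] and [g] from [Int(D)] up to denominators. *)
have [u [u0 Mu lu _]] := gen i; have [g [/loc_IntE lg ->]] := Mu _ Mx.
apply: (loc_mul (J := fun y => exists a, J1 a /\ y = embC a) _ _ lg).
  by move=> y z; apply: prodset_mul.
by apply: comax_mono lu => d [Dd Md]; split=> //; exists (d * u); rewrite /J1 embCM.
Qed.

(** * Surjectivity by gluing local ideals *)

(** By [loc_glue] both intersections localize back to [L i] and [L' i]. That their product is
    [Int(D)] is therefore a local question, answered by [L i L' i = Int(T i)]. *)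
Lemma glue_inverse_pair (L L' : I -> F -> Prop) (s : seq I) :
  (forall i, inverse_pair (IntE (T i)) (L i) (L' i)) ->
  (forall i, normal (L i) /\ normal (L' i)) ->
  (forall i, ~ List.In i s -> forall x, IntE (T i) x -> L i x /\ L' i x) ->
  inverse_pair (IntE D) (fun y => forall i, L i y) (fun y => forall i, L' i y) /\
  forall i x, prodset (fun y => forall i, L i y) (IntE (T i)) x <-> L i x.
Proof.
move=> pL nL LI.
have mcap (N : I -> F -> Prop) : (forall i, submodule (IntE (T i)) (N i)) ->
    submodule (IntE D) (fun y => forall i, N i y).
  move=> mN; split=> [i|x y Nx Ny i|a x Da Nx i]; have [N0 ND NM] := mN i => //.
    by apply: ND.
  by apply: NM => //; apply: IntE_sub.
have mL i : submodule (IntE (T i)) (L i) by case: (pL i).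
have mL' i : submodule (IntE (T i)) (L' i) by case: (pL i).
have gL i x : L i x -> loc i (fun y => forall j, L j y) x.
  by apply: (loc_glue mL (fun i => (nL i).1)) => j js y /(LI j js)[].
have gL' i x : L' i x -> loc i (fun y => forall j, L' j y) x.
  by apply: (loc_glue mL' (fun i => (nL i).2)) => j js y /(LI j js)[].
split; last first.
  move=> i x; split=> [/(prodset_loc _ _ (mcap L mL))|/gL]; last by move/prodset_loc; apply; apply: mcap.
  by apply: loc_le.
split; [exact: mcap|exact: mcap| |].
- move=> x y Lx Ly.
  have Ixy i : IntE (T i) (x * y) by have [_ _ + _] := pL i; apply.
  apply: loc_global => [|i]; first exact: subring_submodule.
  exact: loc_IntE.
have mLL := prodset_submodulel (fun y => forall i, L' i y) (mcap L mL).
apply: loc_global => // i; have [l0 lD lM] := loc_submodule i mLL.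
have [_ _ _] := pL i; apply: prodset_ind => // x y /gL lx /gL' ly.
by apply: loc_mul lx ly => u v; apply: prodset_mul.
Qed.

(** Replace each [Jf i] by a normal representative of its class, choosing [Int(T i)] itself outside
    [s], and intersect. The scalars may vary with [i], since only the local classes are
    prescribed. *)
Lemma local_surjective (Jf : I -> F -> Prop) (s : seq I) :
  (forall i, invertible (IntE (T i)) (Jf i)) ->
  (forall i, ~ List.In i s -> principal (IntE (T i)) (Jf i)) ->
  exists J, invertible (IntE D) J /\
    forall i, same_class (prodset J (IntE (T i))) (Jf i).
Proof.
move=> iJ pJ.
(* The triple holds the scalar, the scaled ideal and its inverse, so that one choice over [i] fixes
   all three. *)
pose P i (q : F * (F -> Prop) * (F -> Prop)) :=
  [/\ q.1.1 != 0, inverse_pair (IntE (T i)) q.1.2 q.2, normal q.1.2 /\ normal q.2,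
    forall y, q.1.2 y <-> Jf i (q.1.1 * y)
    & ~ List.In i s -> forall x, IntE (T i) x -> q.1.2 x /\ q.2 x].
have exP i : exists q, P i q.
  have [ins|nis] := classic (List.In i s).
    have [h [M [M' [h0 pM nM nM' MJ]]]] := normal_form qD (oT i) (iJ i).
    by exists (h, M, M'); split.
  have [h [h0 Jh]] := pJ i nis; exists (h, IntE (T i), IntE (T i)); split=> //=.
  - have mI := subring_submodule (rIT i); split=> //; first exact: subringM.
    by rewrite -[1]mulr1; apply: prodset_mul; apply: (subring1 (rIT i)).
  - by split; apply: normal_IntE.
  - move=> y; split=> [Iy|/Jh[z [Iz /(mulfI h0)->]]//].
    by apply/Jh; exists y.
pose q i := proj1_sig (constructive_indefinite_description _ (exP i)).
have qP i : P i (q i) := proj2_sig (constructive_indefinite_description _ (exP i)).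
have [|||pL Lloc] := glue_inverse_pair (L := fun i => (q i).1.2) (L' := fun i => (q i).2) (s := s).
- by move=> i; have [] := qP i.
- by move=> i; have [] := qP i.
- by move=> i; have [] := qP i.
exists (fun y => forall i, (q i).1.2 y); split; first exact: IntE_invertible oD pL.
move=> i; have [h0 _ _ LJ _] := qP i; exists (q i).1.1^-1; rewrite invr_eq0; split=> // x.
split=> [/Lloc/LJ Jx|[y [Jy ->]]]; first by exists ((q i).1.1 * x); rewrite mulKf.
by apply/Lloc/LJ; rewrite mulVKf.
Qed.

End Jaffard.
End Polynomials.

(* Exactness of 0 -> Pic(D,Theta) -> Pic(Int D) -> (+)_T Pic(Int T) -> 0,
   with Pic classes represented by invertible fractional ideals modulo same_class. *)
Theorem theorem4p4 (K : fieldType) (D : K -> Prop) (I : Type) (T : I -> K -> Prop) :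
  quotient_field_of D -> jaffard D T ->
  [/\ (* first map is well defined on Pic(D,Theta) *)
      (forall J1, in_PicTheta D T J1 -> invertible (IntF D) (extInt D J1))
    /\ (forall J1 J2, in_PicTheta D T J1 -> in_PicTheta D T J2 -> same_class J1 J2 ->
          same_class (extInt D J1) (extInt D J2)),
      (* second map is well defined, with values in the direct sum *)
      (forall J, invertible (IntF D) J ->
          (forall i, invertible (IntF (T i)) (prodset J (IntF (T i))))
          /\ exists s : seq I, forall i, ~ List.In i s -> principal (IntF (T i)) (prodset J (IntF (T i))))
    /\ (forall J1 J2, invertible (IntF D) J1 -> invertible (IntF D) J2 -> same_class J1 J2 ->
          forall i, same_class (prodset J1 (IntF (T i))) (prodset J2 (IntF (T i)))),
      (* exactness at Pic(D,Theta): injectivity *)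
      (forall J1, in_PicTheta D T J1 -> principal (IntF D) (extInt D J1) -> principal D J1),
      (* exactness at Pic(Int D): composite is zero, and kernel is contained in image *)
      (forall J1, in_PicTheta D T J1 ->
          forall i, principal (IntF (T i)) (prodset (extInt D J1) (IntF (T i))))
    /\ (forall J, invertible (IntF D) J ->
          (forall i, principal (IntF (T i)) (prodset J (IntF (T i)))) ->
          exists J1, in_PicTheta D T J1 /\ same_class J (extInt D J1))
    & (* exactness at the direct sum: surjectivity *)
      (forall (Jf : I -> KX K -> Prop) (s : seq I),
          (forall i, invertible (IntF (T i)) (Jf i)) ->
          (forall i, ~ List.In i s -> principal (IntF (T i)) (Jf i)) ->
          exists J, invertible (IntF D) J /\
            forall i, same_class (prodset J (IntF (T i))) (Jf i))].
Proof.
move=> qD jT; pose emb : {rmorphism {poly K} -> KX K} := @FracField.tofrac {poly K}.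
have emb_inj : injective emb by move=> f g /eqP; rewrite tofrac_eq => /eqP.
have emb_frac := @fraction_quotient {poly K}.
split.
- split=> [J1 [iJ1 _]|J1 J2 _ _].
    exact: (extE_invertible emb_inj emb_frac qD iJ1).
  exact: (extE_same_class (emb := emb)).
- split=> [J iJ|J1 J2 _ _ J12 i]; last exact: prodset_same_class.
  split=> [i|]; first exact: (local_invertible emb_inj emb_frac qD jT i iJ).
  exact: (local_principal_cofinite emb_inj qD jT iJ).
- move=> J1 [[[mJ1 nzJ1 _] _] _].
  exact: (extE_principal emb_inj qD nzJ1 mJ1).
- split=> [J1 [_ pJ1] i|J].
    exact: (extE_local_principal emb_inj qD jT (pJ1 i)).
  exact: (local_principal_ext emb_inj qD jT).
exact: (local_surjective emb_inj emb_frac qD jT).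
Qed.
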